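(* For $\alpha,\beta>0$ let $\Phi^{\alpha,\beta}:=\Psi+\Phi_{ch}^{\alpha,\beta}$ be a function on $\mathcal M_{N,K}$, where $\Psi:\mathcal M_{N,K}\to[0,\infty)$ is any real analytic function that does not depend on the parameters $\alpha$ or $\beta$. Let $G\in\mathcal M_{N,K}$ be equal-norm with no zero entries, and suppose that $\nabla\Phi^{\alpha,\beta}(G)=0$ for all $\alpha\in I$ and all $\beta\in J$, where $I,J\subseteq(0,\infty)$ are open intervals. Then $G$ is equidistributed.
   Context: Let $\mathbb F=\mathbb R$ or $\mathbb C$ and let $1\le K\le N$ be integers. $\mathcal M_{N,K}=\{G\in\mathbb F^{N\times N}: G=G^2=G^*,\ \mathrm{tr}(G)=K\}$, regarded as a real analytic submanifold of the Hermitian (resp. symmetric) matrices with the Riemannian metric $X\cdot Y=\mathrm{tr}(XY)$; $\nabla$ is the corresponding Riemannian gradient on $\mathcal M_{N,K}$. $G$ is equal-norm if all its diagonal entries are equal. Indices lie in $\mathbb Z_N$ (so $x+1$ is taken modulo $N$). Open intervals are nonempty. For $x\in\mathbb Z_N$, $\alpha,\beta>0$ the exponential row sum potential is $R_x^{\alpha,\beta}(G)=\frac1\alpha\sum_{j\ne x}e^{\alpha|G_{x,j}|^2}+\beta e^{|G_{x,x}|^2}$, and the chain potential is $\Phi_{ch}^{\alpha,\beta}(G)=\sum_{x\in\mathbb Z_N}\left(R_x^{\alpha,\beta}(G)-R_{x+1}^{\alpha,\beta}(G)\right)^2$. $G$ is equidistributed if for each pair $p,q\in\mathbb Z_N$ there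 exists a permutation $\pi$ of $\mathbb Z_N$ with $|G_{j,p}|=|G_{\pi(j),q}|$ for all $j\in\mathbb Z_N$. *)

(* Defs.v *)
From HB Require Import structures.
From mathcomp Require Import all_boot all_order all_algebra perm.
From mathcomp Require Import complex.
From mathcomp Require Import all_classical all_reals all_analysis.

Set Implicit Arguments.
Unset Strict Implicit.
Unset Printing Implicit Defensive.

Import Order.TTheory GRing.Theory Num.Theory.
Import numFieldNormedType.Exports.

Local Open Scope classical_set_scope.
Local Open Scope complex_scope.
Local Open Scope ring_scope.

Variant scalar_kind := RealScalars | ComplexScalars.

Definition scalar_field (R : realType) (k : scalar_kind) : numFieldType :=
  match k with
  | RealScalars => R
  | ComplexScalars => R[i]
  end.

Definition scalar_re (R : realType) (k : scalar_kind) : scalar_field R k -> R :=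
  match k with
  | RealScalars => fun z => z
  | ComplexScalars => fun z => complex.Re z
  end.

Definition scalar_im (R : realType) (k : scalar_kind) : scalar_field R k -> R :=
  match k with
  | RealScalars => fun _ => 0
  | ComplexScalars => fun z => complex.Im z
  end.

Definition scalar_conj (R : realType) (k : scalar_kind) :
    scalar_field R k -> scalar_field R k :=
  match k with
  | RealScalars => fun z => z
  | ComplexScalars => fun z => conjc z
  end.

(* The MathComp norm of a scalar is again a scalar (a nonnegative real seen in
   the field); [modulus] is the same number as an element of R. *)
Definition modulus (R : realType) (k : scalar_kind) (z : scalar_field R k) : R :=
  scalar_re `|z|.

Section Grassmannian.
Variables (R : realType) (k : scalar_kind) (N : nat).
Local Notation F := (scalar_field R k).
Local Notation mat := 'M[F]_N.

Definition adjoint_mx (A : mat) : mat := map_mx (@scalar_conj R k) A^T.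

Definition grassmannian (K : nat) : set mat :=
  [set G | [/\ G = G *m G, G = adjoint_mx G & \tr G = K%:R]].

(* tr(XY) is real for self-adjoint X and Y; taking the real part only changes
   its type from the scalar field to R. *)
Definition trace_inner (X Y : mat) : R := scalar_re (\tr (X *m Y)).

(* A matrix is identified with the family of the real and imaginary parts of
   its entries (for real scalars the imaginary coordinates are all 0). *)
Definition mx_coord (A : mat) (t : 'I_N * 'I_N * bool) : R :=
  if t.2 then scalar_im (A t.1.1 t.1.2) else scalar_re (A t.1.1 t.1.2).

Definition smooth_curve (M : set mat) (gamma : R -> mat) : Prop :=
  (forall t : R, M (gamma t)) /\
  (forall c (n : nat) (t : R),
     derivable (derive1n n (fun s : R => mx_coord (gamma s) c)) t 1).

Definition has_velocity (gamma : R -> mat) (X : mat) : Prop :=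
  forall c,
    is_derive (0 : R) (1 : R)
      (fun s : R => mx_coord (gamma s) c) (mx_coord X c).

Definition tangent_space (M : set mat) (G : mat) : set mat :=
  [set X | exists gamma : R -> mat,
     [/\ smooth_curve M gamma, gamma 0 = G & has_velocity gamma X]].

(* V is the Riemannian gradient at G of a function on the submanifold M: it is
   the tangent vector representing the differential of f, the differential
   being computed along curves in M. Only the values of f on M matter. *)
Definition is_riemannian_gradient
    (M : set mat) (f : mat -> R) (G V : mat) : Prop :=
  tangent_space M G V /\
  forall (gamma : R -> mat) (X : mat),
    smooth_curve M gamma -> gamma 0 = G -> has_velocity gamma X ->
    is_derive (0 : R) (1 : R) (fun t : R => f (gamma t)) (trace_inner V X).

End Grassmannian.

Arguments grassmannian R k N K : clear implicits.

Section RealAnalytic.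
Variable R : realType.

(* Partial sum, over the multi-indices with all exponents < m, of the power
   series in the variables indexed by T with coefficients c. *)
Definition power_series_partial (T : finType) (c : (T -> nat) -> R)
    (y : T -> R) (m : nat) : R :=
  \sum_(nu : {ffun T -> 'I_m})
     c (fun t => nat_of_ord (nu t)) * \prod_(t : T) y t ^+ nu t.

(* g is the sum of an absolutely convergent power series centred at a, on a
   polydisc around a. *)
Definition real_analytic_at (T : finType) (g : (T -> R) -> R) (a : T -> R) :
    Prop :=
  exists2 r : R, 0 < r &
  exists c : (T -> nat) -> R,
  forall y : T -> R, (forall t, `|y t| < r) ->
    cvgn (power_series_partial (fun nu => `|c nu|) (fun t => `|y t|)) /\
    power_series_partial c y @ \oo --> g (fun t => a t + y t).

(* A function on a submanifold M of a matrix space is real analytic if near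
   each point of M it is the restriction of a real analytic function of the
   ambient real coordinates. Only the values of f on M matter. *)
Definition real_analytic_on (k : scalar_kind) (N : nat)
    (M : set 'M[scalar_field R k]_N) (f : 'M[scalar_field R k]_N -> R) : Prop :=
  forall G, M G ->
  exists2 g : ('I_N * 'I_N * bool -> R) -> R,
    real_analytic_at g (mx_coord G) &
    exists2 e : R, 0 < e &
      forall H, M H -> (forall t, `|mx_coord H t - mx_coord G t| < e) ->
        f H = g (mx_coord H).

End RealAnalytic.

Section Potentials.
Variables (R : realType) (k : scalar_kind) (N : nat).
Local Notation mat := 'M[scalar_field R k]_N.

Definition row_sum_potential (alpha beta : R) (x : 'I_N) (G : mat) : R :=
  alpha^-1 * (\sum_(j < N | j != x) expR (alpha * modulus (G x j) ^+ 2))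
  + beta * expR (modulus (G x x) ^+ 2).

(* [ordS x] is x + 1 modulo N. *)
Definition chain_potential (alpha beta : R) (G : mat) : R :=
  \sum_(x < N) (row_sum_potential alpha beta x G
                - row_sum_potential alpha beta (ordS x) G) ^+ 2.

Definition equal_norm (G : mat) : Prop := forall i j, G i i = G j j.

Definition equidistributed (G : mat) : Prop :=
  forall p q : 'I_N, exists pi : 'S_N,
    forall j : 'I_N, modulus (G j p) = modulus (G (pi j) q).

End Potentials.

(* Main.v *)
Require Import Defs.
From HB Require Import structures.
From mathcomp Require Import all_boot all_order all_algebra perm.
From mathcomp Require Import complex.
From mathcomp Require Import all_classical all_reals all_analysis.
From mathcomp Require Import ring.

Import Order.TTheory GRing.Theory Num.Theory.
Import numFieldNormedType.Exports.

Local Open Scope classical_set_scope.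
Local Open Scope ring_scope.

(** Write A_x for the sum over j <> x of exp (alpha |G_{x,j}|^2). The claim is
    reached by showing that, for every alpha in I, A_x is independent of x.

    Since G has constant diagonal, R_x - R_{x+1} = (A_x - A_{x+1}) / alpha at G,
    whereas the derivative of R_x along a curve contains beta times the
    derivative of exp |G_{x,x}|^2. Hence the derivative of Phi along a curve with
    velocity X is affine in beta, and comparing two values of beta isolates its
    slope: the sum over x of (A_x - A_{x+1}) (X_{x,x} - X_{x+1,x+1}) vanishes
    for every tangent vector X ([critical_row_sum_balance]). The potential Psi
    drops out of the comparison.

    The tangent vectors used are commutators of G with the generators of the
    rotations in the plane of two coordinates p and q. The corresponding curves
    U(t) G U(t)^* stay in the manifold and have trigonometric polynomials as
    coordinates ([conj_rotation_curve]). Because G_{q,p} is not zero, a suitable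
    phase makes the diagonal of X a nonzero multiple of e_p - e_q
    ([plane_generator_commutator_diag]). Letting p and q vary, the resulting
    equations force A to be constant on the cycle ([cyclic_balance_const]).

    Adding the common diagonal term, the full sums of exp (alpha |G_{x,j}|^2)
    over j do not depend on x either. Exponentials with distinct exponents are
    linearly independent on any nonempty open set, so the multiset of the
    |G_{x,j}|^2 is the same for all rows x ([exp_sums_perm_eq]); by
    self-adjointness the same holds for the columns. *)

(** * Scalars of either field through their real coordinates *)

Definition real_scalar {R : realType} (k : scalar_kind) (r : R) :
    scalar_field R k :=
  match k with
  | RealScalars => r
  | ComplexScalars => (r +i* 0)%C
  end.

Lemma scalar_conjD {R : realType} {k : scalar_kind} (x y : scalar_field R k) :
  scalar_conj (x + y) = scalar_conj x + scalar_conj y.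
Proof. by case: k x y => //= x y; rewrite -rmorphD. Qed.

Lemma scalar_conjN {R : realType} {k : scalar_kind} (x : scalar_field R k) :
  scalar_conj (- x) = - scalar_conj x.
Proof. by case: k x => //= x; rewrite -rmorphN. Qed.

Lemma scalar_conjM {R : realType} {k : scalar_kind} (x y : scalar_field R k) :
  scalar_conj (x * y) = scalar_conj x * scalar_conj y.
Proof. by case: k x y => //= x y; rewrite -rmorphM. Qed.

Lemma scalar_conj0 {R : realType} {k : scalar_kind} :
  scalar_conj (0 : scalar_field R k) = 0.
Proof. by case: k => //; exact: conjc0. Qed.

Lemma scalar_conj1 {R : realType} {k : scalar_kind} :
  scalar_conj (1 : scalar_field R k) = 1.
Proof. by case: k => //; exact: conjc1. Qed.

Lemma scalar_conjK {R : realType} {k : scalar_kind} :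
  involutive (@scalar_conj R k).
Proof. by case: k => //= x; rewrite conjcK. Qed.

Lemma scalar_conj_real {R : realType} (k : scalar_kind) (r : R) :
  scalar_conj (real_scalar k r) = real_scalar k r.
Proof. by case: k => //=; rewrite oppr0. Qed.

Lemma real_scalar0 {R : realType} (k : scalar_kind) :
  real_scalar k (0 : R) = 0.
Proof. by case: k. Qed.

Lemma real_scalar1 {R : realType} (k : scalar_kind) :
  real_scalar k (1 : R) = 1.
Proof. by case: k. Qed.

Lemma real_scalarD {R : realType} (k : scalar_kind) (r s : R) :
  real_scalar k (r + s) = real_scalar k r + real_scalar k s.
Proof. by case: k => //=; rewrite -[RHS]/((r + s) +i* (0 + 0))%C addr0. Qed.

Lemma real_scalarN {R : realType} (k : scalar_kind) (r : R) :
  real_scalar k (- r) = - real_scalar k r.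
Proof. by case: k => //=; rewrite -[RHS]/((- r) +i* (- 0))%C oppr0. Qed.

Lemma real_scalarM {R : realType} (k : scalar_kind) (r s : R) :
  real_scalar k (r * s) = real_scalar k r * real_scalar k s.
Proof.
case: k => //=.
rewrite -[RHS]/((r * s - 0 * 0) +i* (r * 0 + 0 * s))%C.
by rewrite !(mul0r, mulr0) subr0 addr0.
Qed.

Lemma scalar_reD {R : realType} {k : scalar_kind} (x y : scalar_field R k) :
  scalar_re (x + y) = scalar_re x + scalar_re y.
Proof. by case: k x y => //= -[a b] [c d]. Qed.

Lemma scalar_imD {R : realType} {k : scalar_kind} (x y : scalar_field R k) :
  scalar_im (x + y) = scalar_im x + scalar_im y.
Proof. by case: k x y => [|[a b] [c d]] //=; rewrite addr0. Qed.

Lemma scalar_reZ {R : realType} {k : scalar_kind} r (x : scalar_field R k) :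
  scalar_re (real_scalar k r * x) = r * scalar_re x.
Proof. by case: k x => //= -[a b] /=; rewrite mul0r subr0. Qed.

Lemma scalar_imZ {R : realType} {k : scalar_kind} r (x : scalar_field R k) :
  scalar_im (real_scalar k r * x) = r * scalar_im x.
Proof. by case: k x => [x|[a b]] //=; rewrite ?mulr0 // mul0r addr0. Qed.

Lemma scalar_re_real {R : realType} (k : scalar_kind) (r : R) :
  scalar_re (real_scalar k r) = r.
Proof. by case: k. Qed.

Lemma scalar_im_conj {R : realType} {k : scalar_kind} (x : scalar_field R k) :
  scalar_im (scalar_conj x) = - scalar_im x.
Proof. by case: k x => [x|[a b]] //=; rewrite oppr0. Qed.

Lemma modulus_complexE {R : realType} (a b : R) :
  modulus ((a +i* b)%C : scalar_field R ComplexScalars) =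
    Num.sqrt (a ^+ 2 + b ^+ 2).
Proof. by []. Qed.

Lemma sqr_modulus {R : realType} {k : scalar_kind} (z : scalar_field R k) :
  modulus z ^+ 2 = scalar_re z ^+ 2 + scalar_im z ^+ 2.
Proof.
case: k z => [z|[a b]].
  by rewrite /modulus /= real_normK ?num_real // expr0n addr0.
by rewrite modulus_complexE /= sqr_sqrtr // addr_ge0 // sqr_ge0.
Qed.

Lemma modulus_ge0 {R : realType} {k : scalar_kind} (z : scalar_field R k) :
  0 <= modulus z.
Proof.
case: k z => [z|[a b]]; first exact: normr_ge0.
by rewrite modulus_complexE sqrtr_ge0.
Qed.

Lemma modulus_conj {R : realType} {k : scalar_kind} (z : scalar_field R k) :
  modulus (scalar_conj z) = modulus z.
Proof. by case: k z => [//|[a b]]; rewrite !modulus_complexE sqrrN. Qed.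

Lemma modulus_eq0 {R : realType} {k : scalar_kind} (z : scalar_field R k) :
  (modulus z == 0) = (z == 0).
Proof.
rewrite -sqrf_eq0 sqr_modulus; case: k z => [z|[a b]] /=.
  by rewrite expr0n addr0 sqrf_eq0.
by rewrite paddr_eq0 ?sqr_ge0 // !sqrf_eq0 eq_complex.
Qed.

Lemma mul_scalar_conj {R : realType} {k : scalar_kind} (z : scalar_field R k) :
  scalar_conj z * z = real_scalar k (modulus z ^+ 2).
Proof.
rewrite sqr_modulus; case: k z => [z|[a b]] /=; first by rewrite expr0n addr0.
by apply/eqP; rewrite eq_complex /=; apply/andP; split; apply/eqP; ring.
Qed.

(** Over either field a nonzero scalar is turned into its modulus by a unit
    factor; this is what makes the real and the complex cases uniform. *)
Lemma unit_phase {R : realType} {k : scalar_kind} (z : scalar_field R k) :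
  z != 0 ->
  exists2 u : scalar_field R k,
    u * scalar_conj u = 1 & u * z = real_scalar k (modulus z).
Proof.
move=> z0; have m0 : modulus z != 0 by rewrite modulus_eq0.
exists (real_scalar k (modulus z)^-1 * scalar_conj z); last first.
  by rewrite -mulrA mul_scalar_conj -real_scalarM expr2 mulKf.
rewrite scalar_conjM scalar_conj_real scalar_conjK mulrACA mul_scalar_conj.
by rewrite -!real_scalarM -expr2 -exprMn mulVf // expr1n real_scalar1.
Qed.

(** * Differentiation of real functions *)

(** This rule and the following ones speak of functions given by their values,
    the form in which the potentials appear once composed with a curve. *)
Lemma is_derive_add {R : realType} (f g : R -> R) (t df dg : R) :
  is_derive t 1 f df -> is_derive t 1 g dg ->
  is_derive t 1 (fun s => f s + g s) (df + dg).
Proof. exact: is_deriveD. Qed.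

Lemma is_derive_sub {R : realType} (f g : R -> R) (t df dg : R) :
  is_derive t 1 f df -> is_derive t 1 g dg ->
  is_derive t 1 (fun s => f s - g s) (df - dg).
Proof. exact: is_deriveB. Qed.

Lemma is_derive_mul {R : realType} (f g : R -> R) (t df dg : R) :
  is_derive t 1 f df -> is_derive t 1 g dg ->
  is_derive t 1 (fun s => f s * g s) (f t * dg + g t * df).
Proof. exact: is_deriveM. Qed.

Lemma is_derive_scale {R : realType} (a : R) (f : R -> R) (t df : R) :
  is_derive t 1 f df -> is_derive t 1 (fun s => a * f s) (a * df).
Proof. exact: is_deriveZ. Qed.

Lemma is_derive_sqr {R : realType} (f : R -> R) (t df : R) :
  is_derive t 1 f df -> is_derive t 1 (fun s => f s ^+ 2) (2 * f t * df).
Proof. by move=> hf; apply: is_derive_eq (is_deriveX 2 hf) _; rewrite expr1. Qed.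

Lemma is_derive_bigsum {R : realType} (n : nat) (P : pred 'I_n)
    (f : 'I_n -> R -> R) (df : 'I_n -> R) (t : R) :
  (forall i, P i -> is_derive t 1 (f i) (df i)) ->
  is_derive t 1 (fun s => \sum_(i < n | P i) f i s) (\sum_(i < n | P i) df i).
Proof.
move=> hf; rewrite (_ : (fun s => _) = \sum_(i < n | P i) f i); last first.
  by apply/funext => s; rewrite fct_sumE.
elim/big_ind2 : _ => [|g dg h dh|i Pi]; [exact: is_derive_cst| |exact: hf].
exact: is_deriveD.
Qed.

(** The space of these combinations is stable under derivation, because
    cos^2 = 1 - sin^2; hence its members are infinitely differentiable. *)
Definition trig_poly {R : realType} (a b c d e : R) (t : R) : R :=
  a + sin t * b + cos t * c + sin t ^+ 2 * d + sin t * cos t * e.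

Lemma is_derive_trig_poly {R : realType} (a b c d e t : R) :
  is_derive t 1 (trig_poly a b c d e) (trig_poly e (- c) b (- 2 * e) (2 * d) t).
Proof.
have hs := is_derive_sin t; have hc := is_derive_cos t.
have hf := is_derive_add _ _ _ _ _ (is_derive_add _ _ _ _ _
  (is_derive_add _ _ _ _ _ (is_derive_add _ _ _ _ _ (is_derive_cst a t 1)
    (is_derive_scale b _ _ _ hs)) (is_derive_scale c _ _ _ hc))
  (is_derive_scale d _ _ _ (is_derive_sqr _ _ _ hs)))
  (is_derive_scale e _ _ _ (is_derive_mul _ _ _ _ _ hs hc)).
rewrite (_ : trig_poly a b c d e = fun s => a + b * sin s + c * cos s
  + d * sin s ^+ 2 + e * (sin s * cos s)); last first.
  by apply/funext => s; rewrite /trig_poly; ring.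
apply: is_derive_eq hf _; rewrite /trig_poly.
have cs : cos t ^+ 2 = 1 - sin t ^+ 2 by rewrite -(cos2Dsin2 t) addrK.
ring: cs.
Qed.

Lemma derivable_trig_poly {R : realType} (n : nat) (a b c d e t : R) :
  derivable (derive1n n (trig_poly a b c d e)) t 1.
Proof.
have [a' [b' [c' [d' [e' ->]]]]] : exists a' b' c' d' e',
    derive1n n (trig_poly a b c d e) = trig_poly a' b' c' d' e'.
  elim: n => [|n [a' [b' [c' [d' [e' IH]]]]]]; first by exists a, b, c, d, e.
  exists e', (- c'), b', (- 2 * e'), (2 * d').
  rewrite derive1nS IH; apply/funext => s.
  rewrite derive1E.
  exact: (@derive_val _ _ _ _ _ _ _ (is_derive_trig_poly _ _ _ _ _ s)).
exact: (@ex_derive _ _ _ _ _ _ _ (is_derive_trig_poly _ _ _ _ _ t)).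
Qed.

(** * Rotation of a projection by a one-parameter unitary group *)

Lemma mx_coordD {R : realType} {k : scalar_kind} {N : nat}
    (A B : 'M[scalar_field R k]_N) (c : 'I_N * 'I_N * bool) :
  mx_coord (A + B) c = mx_coord A c + mx_coord B c.
Proof. by rewrite /mx_coord !mxE scalar_reD scalar_imD; case: c.2. Qed.

Lemma mx_coordZ {R : realType} {k : scalar_kind} {N : nat} (r : R)
    (A : 'M[scalar_field R k]_N) (c : 'I_N * 'I_N * bool) :
  mx_coord (real_scalar k r *: A) c = r * mx_coord A c.
Proof. by rewrite /mx_coord !mxE scalar_reZ scalar_imZ; case: c.2. Qed.

Lemma adjoint_mxD {R : realType} {k : scalar_kind} {N : nat}
    (A B : 'M[scalar_field R k]_N) :
  adjoint_mx (A + B) = adjoint_mx A + adjoint_mx B.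
Proof. by apply/matrixP => i j; rewrite !mxE scalar_conjD. Qed.

Lemma adjoint_mxN {R : realType} {k : scalar_kind} {N : nat}
    (A : 'M[scalar_field R k]_N) :
  adjoint_mx (- A) = - adjoint_mx A.
Proof. by apply/matrixP => i j; rewrite !mxE scalar_conjN. Qed.

Lemma adjoint_mxZ {R : realType} {k : scalar_kind} {N : nat}
    (a : scalar_field R k) (A : 'M[scalar_field R k]_N) :
  adjoint_mx (a *: A) = scalar_conj a *: adjoint_mx A.
Proof. by apply/matrixP => i j; rewrite !mxE scalar_conjM. Qed.

Lemma adjoint_mxM {R : realType} {k : scalar_kind} {N : nat}
    (A B : 'M[scalar_field R k]_N) :
  adjoint_mx (A *m B) = adjoint_mx B *m adjoint_mx A.
Proof.
apply/matrixP => i j; rewrite !mxE.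
rewrite (big_morph _ (@scalar_conjD R k) scalar_conj0).
by apply: eq_bigr => l _; rewrite !mxE scalar_conjM mulrC.
Qed.

Lemma adjoint_mxK {R : realType} {k : scalar_kind} {N : nat} :
  involutive (@adjoint_mx R k N).
Proof. by move=> A; apply/matrixP => i j; rewrite !mxE scalar_conjK. Qed.

Lemma adjoint_mx1 {R : realType} {k : scalar_kind} {N : nat} :
  adjoint_mx (1%:M : 'M[scalar_field R k]_N) = 1%:M.
Proof.
apply/matrixP => i j; rewrite !mxE eq_sym.
by case: eqP => _; rewrite ?scalar_conj0 ?scalar_conj1.
Qed.

Lemma adjoint_delta_mx {R : realType} {k : scalar_kind} {N : nat}
    (p q : 'I_N) :
  adjoint_mx (delta_mx p q : 'M[scalar_field R k]_N) = delta_mx q p.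
Proof.
apply/matrixP => i j; rewrite !mxE andbC.
by case: andP => _; rewrite ?scalar_conj0 ?scalar_conj1.
Qed.

Lemma grassmannian_conj {R : realType} {k : scalar_kind} {N K : nat}
    (G U : 'M[scalar_field R k]_N) :
  U *m adjoint_mx U = 1%:M -> grassmannian R k N K G ->
  grassmannian R k N K (U *m G *m adjoint_mx U).
Proof.
move=> UU [GG Ga Gt]; have UU' := mulmx1C UU; split.
- rewrite !mulmxA -[_ *m adjoint_mx U *m U]mulmxA UU' mulmx1.
  by rewrite -[U *m G *m G]mulmxA -GG.
- by rewrite !adjoint_mxM adjoint_mxK -Ga mulmxA.
- by rewrite mxtrace_mulC mulmxA UU' mul1mx.
Qed.

Lemma real_scalar_cos2 {R : realType} (k : scalar_kind) (t : R) :
  real_scalar k (cos t) ^+ 2 = 1 - real_scalar k (sin t) ^+ 2.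
Proof.
rewrite !expr2 -!real_scalarM -!expr2 -real_scalar1 -real_scalarN.
by rewrite -real_scalarD -(cos2Dsin2 t) addrK.
Qed.

(** The one-parameter group exp(tS) of a skew-adjoint S with S^3 = - S, by the
    formula of Rodrigues. *)
Definition rotation {R : realType} {k : scalar_kind} {N : nat}
    (S : 'M[scalar_field R k]_N) (t : R) : 'M[scalar_field R k]_N :=
  1%:M + real_scalar k (sin t) *: S
  + real_scalar k (1 - cos t) *: (S *m S).

Lemma rotation0 {R : realType} {k : scalar_kind} {N : nat}
    (S : 'M[scalar_field R k]_N) :
  rotation S 0 = 1%:M.
Proof.
by rewrite /rotation sin0 cos0 subrr real_scalar0 !scale0r !addr0.
Qed.

Lemma adjoint_rotation {R : realType} {k : scalar_kind} {N : nat}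
    (S : 'M[scalar_field R k]_N) (t : R) :
  adjoint_mx S = - S ->
  adjoint_mx (rotation S t) = 1%:M - real_scalar k (sin t) *: S
                              + real_scalar k (1 - cos t) *: (S *m S).
Proof.
move=> Sa; rewrite /rotation !adjoint_mxD !adjoint_mxZ !scalar_conj_real.
by rewrite adjoint_mx1 adjoint_mxM Sa mulmxN mulNmx opprK scalerN.
Qed.

(** Writing s and c for the sine and cosine, the product is
    (1 + (1 - c) S^2)^2 - s^2 S^2, and S^4 = - S^2 makes the coefficient of
    S^2 equal to 1 - c^2 - s^2 = 0. *)
Lemma rotation_unitary {R : realType} {k : scalar_kind} {N : nat}
    (S : 'M[scalar_field R k]_N) (t : R) :
  adjoint_mx S = - S -> S *m S *m S = - S ->
  rotation S t *m adjoint_mx (rotation S t) = 1%:M.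
Proof.
move=> Sa S3; rewrite adjoint_rotation // /rotation.
have S3' : S *m (S *m S) = - S by rewrite mulmxA.
have S4 : S *m S *m (S *m S) = - (S *m S) by rewrite mulmxA S3 mulNmx.
rewrite !(mulmxDl, mulmxDr, mulmxN, mulNmx, mul1mx, mulmx1).
rewrite -!(scalemxAl, scalemxAr) S3 S3' S4.
move: (S *m S) => T; apply/matrixP => i j; rewrite !mxE.
have cs := real_scalar_cos2 k t.
rewrite !(real_scalarD, real_scalarN) real_scalar1.
ring: cs.
Qed.

(** Expanding the triple product and replacing cos^2 by 1 - sin^2 leaves only
    the five functions of [trig_poly]; this is how the curve is seen to be
    smooth. *)
Lemma conj_rotation_trig_poly {R : realType} {k : scalar_kind} {N : nat}
    (S G : 'M[scalar_field R k]_N) (t : R) (c : 'I_N * 'I_N * bool) :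
  adjoint_mx S = - S ->
  let T := S *m S in let P := 1%:M + T in
  mx_coord (rotation S t *m G *m adjoint_mx (rotation S t)) c =
  trig_poly (mx_coord (P *m G *m P + T *m G *m T) c)
    (mx_coord (S *m G *m P - P *m G *m S) c)
    (mx_coord (- (T *m G *m P + P *m G *m T)) c)
    (mx_coord (- (S *m G *m S + T *m G *m T)) c)
    (mx_coord (T *m G *m S - S *m G *m T) c) t.
Proof.
move=> Sa T P; rewrite adjoint_rotation // /rotation /trig_poly.
rewrite -!mx_coordZ -!mx_coordD; congr mx_coord.
rewrite /P !(mulmxDl, mulmxDr, mulmxN, mulNmx, mul1mx, mulmx1) -/T.
rewrite -!(scalemxAl, scalemxAr).
move: (S *m G) (G *m S) (T *m G) (G *m T) (S *m G *m S) (S *m G *m T)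
  (T *m G *m S) (T *m G *m T).
have cs := real_scalar_cos2 k t.
move=> A1 A2 A3 A4 A5 A6 A7 A8; apply/matrixP => i j; rewrite !mxE.
rewrite !(real_scalarD, real_scalarN, real_scalarM) real_scalar1.
ring: cs.
Qed.

(** Every skew-adjoint S with S^3 = - S gives an admissible curve through the
    projection G, whose velocity is the commutator of S and G. *)
Lemma conj_rotation_curve {R : realType} {k : scalar_kind} {N K : nat}
    (S G : 'M[scalar_field R k]_N) :
  adjoint_mx S = - S -> S *m S *m S = - S -> grassmannian R k N K G ->
  let gamma := fun t => rotation S t *m G *m adjoint_mx (rotation S t) in
  [/\ smooth_curve (grassmannian R k N K) gamma, gamma 0 = G
    & has_velocity gamma (S *m G - G *m S)].
Proof.
move=> Sa S3 hG gamma; split.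
- split=> [t|c n t].
    by apply: grassmannian_conj => //; exact: rotation_unitary.
  under eq_fun do rewrite conj_rotation_trig_poly //.
  exact: derivable_trig_poly.
- by rewrite /gamma rotation0 adjoint_mx1 mul1mx mulmx1.
- move=> c; under eq_fun do rewrite conj_rotation_trig_poly //.
  apply: is_derive_eq (is_derive_trig_poly _ _ _ _ _ _) _.
  rewrite /trig_poly sin0 cos0 expr0n !(mul0r, mul1r, addr0) -mx_coordD.
  congr mx_coord.
  rewrite !(mulmxDl, mulmxDr, mulmxN, mulNmx, mul1mx, mulmx1).
  move: (S *m G) (G *m S) (S *m G *m (S *m S)) (S *m S *m G *m S) => A1 A2 A3 A4.
  by apply/matrixP => i j; rewrite !mxE; ring.
Qed.

(** * Rotations in a coordinate plane *)

(** The generator of the rotations of the plane spanned by the p-th and q-th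
    basis vectors, with phase u. *)
Definition plane_generator {R : realType} {k : scalar_kind} {N : nat}
    (u : scalar_field R k) (p q : 'I_N) : 'M[scalar_field R k]_N :=
  u *: delta_mx p q - scalar_conj u *: delta_mx q p.

Lemma plane_generator_skew {R : realType} {k : scalar_kind} {N : nat}
    (u : scalar_field R k) (p q : 'I_N) :
  adjoint_mx (plane_generator u p q) = - plane_generator u p q.
Proof.
rewrite /plane_generator adjoint_mxD adjoint_mxN !adjoint_mxZ scalar_conjK.
by rewrite !adjoint_delta_mx opprB addrC.
Qed.

Lemma plane_generator_cube {R : realType} {k : scalar_kind} {N : nat}
    (u : scalar_field R k) (p q : 'I_N) :
  p != q -> u * scalar_conj u = 1 ->
  let S := plane_generator u p q in S *m S *m S = - S.
Proof.
move=> pq uu S; have uu' : scalar_conj u * u = 1 by rewrite mulrC.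
have -> : S *m S = - (delta_mx p p + delta_mx q q).
  rewrite /S /plane_generator !(mulmxDl, mulmxDr, mulmxN, mulNmx).
  rewrite -!(scalemxAl, scalemxAr) !mul_delta_mx_cond !eqxx (negbTE pq).
  rewrite eq_sym (negbTE pq) !mulr0n !mulr1n !scalerA uu uu' !scale1r.
  by rewrite !scaler0 add0r opprK addr0 opprD addrC.
rewrite /S /plane_generator !(mulmxDl, mulmxDr, mulmxN, mulNmx).
rewrite -!(scalemxAl, scalemxAr) !mul_delta_mx_cond !eqxx (negbTE pq).
rewrite eq_sym (negbTE pq) !mulr0n !mulr1n.
by apply/matrixP => i j; rewrite !mxE; ring.
Qed.

(** The phase u is chosen so that u G_{q,p} is real: the rotation then moves
    norm from the q-th to the p-th diagonal entry at a speed that is nonzero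
    exactly when G_{q,p} is. *)
Lemma plane_generator_commutator_diag {R : realType} {k : scalar_kind} {N : nat}
    (u : scalar_field R k) (p q x : 'I_N) (G : 'M[scalar_field R k]_N) :
  G = adjoint_mx G -> u * G q p = real_scalar k (modulus (G q p)) ->
  let S := plane_generator u p q in
  scalar_re ((S *m G - G *m S) x x) =
    2 * modulus (G q p) * ((x == p)%:R - (x == q)%:R).
Proof.
move=> Ga uG S; set m := modulus _ in uG *.
have uG' : scalar_conj u * G p q = real_scalar k m.
  by rewrite {1}Ga !mxE -scalar_conjM uG scalar_conj_real.
have dl a b : (delta_mx a b *m G) x x = (x == a)%:R * G b a.
  rewrite mxE (bigD1 b) //= big1 ?addr0 ?mxE ?eqxx ?andbT.
    by case: eqP => [->//|_]; rewrite !mul0r.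
  by move=> i ib; rewrite mxE (negbTE ib) andbF mul0r.
have dr a b : (G *m delta_mx a b) x x = (x == b)%:R * G b a.
  rewrite mxE (bigD1 a) //= big1 ?addr0 ?mxE ?eqxx //=.
    by case: eqP => [->|_]; rewrite ?mulr1 ?mul1r ?mulr0 ?mul0r.
  by move=> i ia; rewrite mxE (negbTE ia) mulr0.
have -> : (S *m G - G *m S) x x =
    real_scalar k (2 * m * ((x == p)%:R - (x == q)%:R)).
  rewrite /S /plane_generator !(mulmxDl, mulmxDr, mulmxN, mulNmx).
  rewrite -!(scalemxAl, scalemxAr).
  have e (A1 A2 A3 A4 : 'M[scalar_field R k]_N) (a b : scalar_field R k) :
      (a *: A1 - b *: A2 - (a *: A3 - b *: A4)) x x =
      a * A1 x x - b * A2 x x - a * A3 x x + b * A4 x x.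
    by rewrite !mxE; ring.
  rewrite e !dl !dr !(mulrCA u) !(mulrCA (scalar_conj u)) uG uG'.
  have nat_real (b : bool) : b%:R = real_scalar k b%:R.
    by case: b; rewrite ?real_scalar0 ?real_scalar1.
  rewrite !nat_real -!real_scalarM -!real_scalarN -!real_scalarD.
  by congr real_scalar; ring.
exact: scalar_re_real.
Qed.

(** * The chain potential along a curve *)

Lemma is_derive_sqr_modulus {R : realType} {k : scalar_kind} {N : nat}
    (gamma : R -> 'M[scalar_field R k]_N) (X : 'M[scalar_field R k]_N)
    (i j : 'I_N) :
  has_velocity gamma X ->
  is_derive (0 : R) 1 (fun t => modulus (gamma t i j) ^+ 2)
    (2 * scalar_re (gamma 0 i j) * scalar_re (X i j)
     + 2 * scalar_im (gamma 0 i j) * scalar_im (X i j)).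
Proof.
move=> gX; under eq_fun do rewrite sqr_modulus.
exact: is_derive_add (is_derive_sqr _ _ _ (gX (i, j, false)))
  (is_derive_sqr _ _ _ (gX (i, j, true))).
Qed.

Lemma is_derive_row_sum_potential {R : realType} {k : scalar_kind} {N : nat}
    (gamma : R -> 'M[scalar_field R k]_N) (alpha beta : R) (x : 'I_N)
    (dm : 'I_N -> 'I_N -> R) :
  (forall i j, is_derive (0 : R) 1 (fun t => modulus (gamma t i j) ^+ 2)
                 (dm i j)) ->
  is_derive (0 : R) 1 (fun t => row_sum_potential alpha beta x (gamma t))
    (alpha^-1 * (\sum_(j < N | j != x)
        expR (alpha * modulus (gamma 0 x j) ^+ 2) * (alpha * dm x j))
     + beta * (expR (modulus (gamma 0 x x) ^+ 2) * dm x x)).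
Proof.
move=> hm; apply: is_derive_add; apply: is_derive_scale.
(* The diagonal term and the summands are differentiated by the inference of
   [is_derive] instances, starting from hm. *)
exact: is_derive_bigsum.
Qed.

Lemma is_derive_chain_potential {R : realType} {k : scalar_kind} {N : nat}
    (gamma : R -> 'M[scalar_field R k]_N) (alpha beta : R) (dR : 'I_N -> R) :
  (forall x, is_derive (0 : R) 1
     (fun t => row_sum_potential alpha beta x (gamma t)) (dR x)) ->
  is_derive (0 : R) 1 (fun t => chain_potential alpha beta (gamma t))
    (\sum_(x < N) 2 * (row_sum_potential alpha beta x (gamma 0)
                       - row_sum_potential alpha beta (ordS x) (gamma 0))
                  * (dR x - dR (ordS x))).
Proof.
move=> hR; apply: is_derive_bigsum => x _.
by apply: is_derive_sqr; exact: is_derive_sub.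
Qed.

Definition off_diag_row_sum {R : realType} {k : scalar_kind} {N : nat}
    (alpha : R) (G : 'M[scalar_field R k]_N) (x : 'I_N) : R :=
  \sum_(j < N | j != x) expR (alpha * modulus (G x j) ^+ 2).

(** With A_x the off-diagonal row sum, R_x = A_x / alpha + beta exp |G_{x,x}|^2.
    As all diagonal entries of G agree, the beta terms cancel in R_x - R_{x+1}
    at G (but not in its derivative), so the derivative of the chain
    potential is affine in beta, with slope a nonzero multiple of the sum over
    x of (A_x - A_{x+1}) (X_{x,x} - X_{x+1,x+1}). Criticality for two values of
    beta makes that slope vanish, since Psi contributes the same derivative to
    both. *)
Lemma critical_row_sum_balance {R : realType} {k : scalar_kind} {N : nat}
    (M : set 'M[scalar_field R k]_N) (Psi : 'M[scalar_field R k]_N -> R)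
    (alpha beta1 beta2 : R) (G X : 'M[scalar_field R k]_N)
    (gamma : R -> 'M[scalar_field R k]_N) :
  alpha != 0 -> beta1 != beta2 ->
  (forall i, scalar_im (G i i) = 0) -> (forall i, G i i != 0) ->
  equal_norm G ->
  (forall beta, beta \in [:: beta1; beta2] -> is_riemannian_gradient M
      (fun H => Psi H + chain_potential alpha beta H) G 0) ->
  smooth_curve M gamma -> gamma 0 = G -> has_velocity gamma X ->
  \sum_(x < N) (off_diag_row_sum alpha G x - off_diag_row_sum alpha G (ordS x))
    * (scalar_re (X x x) - scalar_re (X (ordS x) (ordS x))) = 0.
Proof.
move=> a0 b12 im0 d0 eqn crit gM g0 gX.
case: N => [|N] in M Psi G X gamma im0 d0 eqn crit gM g0 gX *.
  by rewrite big_ord0.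
pose A x := off_diag_row_sum alpha G x.
pose dm i j := 2 * scalar_re (G i j) * scalar_re (X i j)
  + 2 * scalar_im (G i j) * scalar_im (X i j).
have hm i j : is_derive (0 : R) 1 (fun t => modulus (gamma t i j) ^+ 2) (dm i j).
  by rewrite /dm -g0; exact: is_derive_sqr_modulus.
pose dA x := \sum_(j < N.+1 | j != x)
  expR (alpha * modulus (G x j) ^+ 2) * (alpha * dm x j).
pose g := scalar_re (G ord0 ord0).
pose c := expR (modulus (G ord0 ord0) ^+ 2) * (2 * g).
have c0 : c != 0.
  apply: mulf_neq0; first by rewrite gt_eqF ?expR_gt0.
  apply: mulf_neq0; first by rewrite pnatr_eq0.
  have := d0 ord0; apply: contraNneq => g_eq0.
  rewrite -modulus_eq0 -(sqrf_eq0 (modulus _)) sqr_modulus im0 -/g g_eq0.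
  by rewrite expr0n addr0.
pose a x := A x - A (ordS x).
pose da x := dA x - dA (ordS x).
pose b x := scalar_re (X x x) - scalar_re (X (ordS x) (ordS x)).
(* The left-hand side does not mention beta, so the right-hand side takes the
   same value for both choices; only its last term depends on beta. *)
have dPsi beta : beta \in [:: beta1; beta2] ->
  is_derive (0 : R) 1 (fun t => Psi (gamma t))
    (- (\sum_x 2 * alpha^-1 * a x * (alpha^-1 * da x))
     - beta * (2 * alpha^-1 * c * \sum_x a x * b x)).
  move=> hb; have [_ /(_ gamma X gM g0 gX) dT] := crit beta hb.
  have dR x := is_derive_row_sum_potential gamma alpha beta x dm hm.
  have dC := is_derive_chain_potential gamma alpha beta _ dR.
  have := is_derive_sub _ _ _ _ _ dT dC.
  under eq_fun do rewrite addrK.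
  move=> dP; apply: is_derive_eq dP _.
  rewrite /trace_inner mul0mx mxtrace0.
  have -> : scalar_re (0 : scalar_field R k) = 0 by case: (k).
  rewrite sub0r -opprD !mulr_sumr -big_split /=; congr (- _).
  apply: eq_bigr => x _; rewrite g0 /row_sum_potential.
  have diag y : expR (modulus (G y y) ^+ 2) * dm y y = c * scalar_re (X y y).
    by rewrite /dm im0 (eqn y ord0) /c /g; ring.
  rewrite !diag (eqn x ord0) (eqn (ordS x) ord0).
  by rewrite -/(dA x) -/(dA (ordS x)) /a /A /off_diag_row_sum /da /b; ring.
have h1 := dPsi beta1 (mem_head _ _).
have h2 := dPsi beta2 (mem_last _ [:: beta2]).
have := derive_val (is_derive := h1).
rewrite (derive_val (is_derive := h2)) => /addrI /oppr_inj /eqP.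
rewrite -subr_eq0 -mulrBl mulf_eq0 subr_eq0 eq_sym (negbTE b12) /=.
have k0 : 2 * alpha^-1 * c != 0.
  by apply: mulf_neq0 => //; rewrite mulf_neq0 ?invr_eq0 ?pnatr_eq0.
by rewrite mulf_eq0 (negbTE k0) => /eqP.
Qed.

(** * Constancy on a cycle *)

Lemma ordS_invariant_const {T : Type} {N : nat} (A : 'I_N -> T) :
  (forall x, A (ordS x) = A x) -> forall x y, A x = A y.
Proof.
case: N A => [A _ []//|N A hA].
suff h (n : nat) (hn : (n < N.+1)%N) : A (Ordinal hn) = A ord0.
  by move=> [x hx] [y hy]; rewrite !h.
elim: n hn => [|n IH] hn; first by congr A; apply: val_inj.
rewrite -(IH (ltnW hn)) -[RHS]hA; congr A; apply: val_inj => /=.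
by rewrite modn_small.
Qed.

(** Let L w be the sum over x of (A_x - A_{x+1}) (w_x - w_{x+1}). By hypothesis
    L takes the same value at all the indicator functions of points; these add
    up to the constant function 1, where L vanishes, so L = 0. Evaluating
    L at A itself gives a sum of squares. *)
Lemma cyclic_balance_const {R : realType} {N : nat} (A : 'I_N -> R) :
  (forall p q : 'I_N, p != q ->
    \sum_(x < N) (A x - A (ordS x)) *
      (((x == p)%:R - (x == q)%:R) - ((ordS x == p)%:R - (ordS x == q)%:R)) = 0) ->
  forall x y, A x = A y.
Proof.
move=> hA.
pose l p := \sum_(x < N) (A x - A (ordS x)) * ((x == p)%:R - (ordS x == p)%:R).
have l_const p q : l p = l q.
  have [->//|pq] := eqVneq p q; apply/eqP; rewrite -subr_eq0 -sumrB.
  by rewrite -[X in _ == X](hA p q pq); apply/eqP/eq_bigr => x _; ring.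
have sum_l (w : 'I_N -> R) : \sum_p w p * l p =
    \sum_(x < N) (A x - A (ordS x)) * (w x - w (ordS x)).
  have pick (y : 'I_N) : \sum_p w p * (y == p)%:R = w y.
    rewrite (bigD1 y) //= eqxx mulr1 big1 ?addr0 // => i iy.
    by rewrite eq_sym (negbTE iy) mulr0.
  under eq_bigr do rewrite mulr_sumr.
  rewrite exchange_big; apply: eq_bigr => x _ /=.
  rewrite -[X in _ = _ * (X - _)]pick -[X in _ = _ * (_ - X)]pick.
  rewrite -sumrB mulr_sumr.
  by apply: eq_bigr => p _; ring.
have l0 p : l p = 0.
  have := sum_l (fun _ => 1); rewrite [RHS]big1 => [|x _]; last first.
    by rewrite subrr mulr0.
  rewrite (eq_bigr (fun=> l p)) => [|x _]; last by rewrite mul1r.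
  rewrite sumr_const card_ord => /eqP.
  by rewrite mulrn_eq0 -leqn0 leqNgt (leq_ltn_trans _ (ltn_ord p)) //= => /eqP.
apply: ordS_invariant_const => x.
have := sum_l A; rewrite big1 => [/esym/eqP|p _]; last by rewrite l0 mulr0.
rewrite psumr_eq0 => [|y _]; last by rewrite -expr2 sqr_ge0.
move=> /allP /(_ x (mem_index_enum x)).
by rewrite -expr2 sqrf_eq0 subr_eq0 => /eqP.
Qed.

(** * Multisets of exponents from exponential sums *)

Lemma open_itv_right {R : realType} (I : set R) (a : R) :
  open I -> I a -> exists2 e : R, 0 < e & forall h, 0 <= h < e -> I (a + h).
Proof.
move=> Io Ia; have /nbhs_ballP[e /= e0 he] := open_nbhs_nbhs (conj Io Ia).
exists e => // h /andP[h0 he']; apply: he.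
by rewrite /ball /= opprD addrA subrr sub0r normrN ger0_norm.
Qed.

(** Sampling the two sums at the points a + i h of an arithmetic progression in I
    shows that s and t give the same sum of e^{a v} p(e^{h v}) for all
    polynomials p of bounded degree. As v -> e^{h v} is injective, p can be taken
    to vanish at the nodes of all exponents except one, and what remains
    compares the multiplicities of that exponent. *)
Lemma exp_sums_perm_eq {R : realType} (I : set R) (s t : seq R) :
  open I -> I !=set0 ->
  (forall alpha, I alpha ->
     \sum_(v <- s) expR (alpha * v) = \sum_(v <- t) expR (alpha * v)) ->
  perm_eq s t.
Proof.
move=> Io [a Ia] hE; have [e e0 he] := open_itv_right _ _ Io Ia.
pose L := undup (s ++ t); pose h := e / (size L).+1%:R.
have h0 : 0 < h by rewrite divr_gt0 ?ltr0n.
have hI i : (i < (size L).+1)%N -> I (a + i%:R * h).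
  move=> iL; apply: he; rewrite mulr_ge0 ?ler0n ?(ltW h0) //=.
  by rewrite mulrCA gtr_pMr // ltr_pdivrMr ?ltr0n // mul1r ltr_nat.
have poly_sum (r : seq R) (p : {poly R}) :
    \sum_(v <- r) expR (a * v) * p.[expR (h * v)] =
    \sum_(i < size p) p`_i * \sum_(v <- r) expR ((a + i%:R * h) * v).
  under eq_bigr do rewrite horner_coef mulr_sumr.
  rewrite exchange_big; apply: eq_bigr => i _ /=; rewrite mulr_sumr.
  apply: eq_bigr => v _; rewrite mulrDl expRD -mulrA expRM_natl; ring.
have mem_L v : (v \in L) = (v \in s ++ t) by rewrite mem_undup.
have count_eq v0 : v0 \in s ++ t -> count_mem v0 s = count_mem v0 t.
  move=> v0st.
  (* Up to a factor, the Lagrange basis polynomial of the node of v0. *)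
  pose nodes := [seq expR (h * u) | u <- rem v0 L].
  pose p : {poly R} := \prod_(y <- nodes) ('X - y%:P).
  pose C := expR (a * v0) * p.[expR (h * v0)].
  have C0 : C != 0.
    apply: mulf_neq0; first by rewrite gt_eqF ?expR_gt0.
    rewrite -rootE /p root_prod_XsubC.
    apply/negP => /mapP[u]; rewrite mem_rem_uniq ?undup_uniq // inE.
    move=> /andP[uv0 _] /expR_inj /(mulfI (lt0r_neq0 h0)) /eqP.
    by rewrite eq_sym (negbTE uv0).
  have size_p : (size p <= (size L).+1)%N.
    by rewrite size_prod_XsubC size_map size_rem ?mem_L // ltnS; exact: leq_pred.
  have sumC (r : seq R) : {subset r <= s ++ t} ->
      \sum_(v <- r) expR (a * v) * p.[expR (h * v)] = C *+ count_mem v0 r.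
    move=> rst; rewrite -[RHS]addr0 -iter_addr -big_const_seq [RHS]big_mkcond /=.
    apply: eq_big_seq => v vr; case: eqVneq => [->//|vv0].
    suff /eqP -> : p.[expR (h * v)] == 0 by rewrite mulr0.
    rewrite -rootE /p root_prod_XsubC; apply: map_f.
    by rewrite mem_rem_uniq ?undup_uniq // inE vv0 mem_L rst.
  have : C *+ count_mem v0 s = C *+ count_mem v0 t.
    rewrite -!sumC; [|by move=> v vt; rewrite mem_cat vt orbT
                     |by move=> v vs; rewrite mem_cat vs].
    rewrite !poly_sum; apply: eq_bigr => i _; rewrite hE //.
    by apply: hI; rewrite (leq_trans (ltn_ord i)).
  by move/(mulrIn C0).
by apply/allP => v /count_eq; move/eqP.
Qed.

Lemma perm_eq_codom_perm {T : eqType} {n : nat} (f g : 'I_n -> T) :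
  perm_eq (codom f) (codom g) -> exists pi : 'S_n, forall j, f j = g (pi j).
Proof.
rewrite /codom /image_mem => /(tuple_permP (t := [tuple of map g (ord_tuple n)])).
move=> [pi e]; exists pi => j.
have /eq_in_map/(_ j) : [seq f i | i <- enum 'I_n] =
    [seq g (pi i) | i <- enum 'I_n].
  rewrite e; apply: eq_map => i.
  by rewrite tnth_map tnth_ord_tuple.
by apply; rewrite mem_enum.
Qed.

(** * Critical points are equidistributed *)

(** Columns may be replaced by rows because G is self-adjoint. *)
Lemma row_moduli_equidistributed {R : realType} {k : scalar_kind} {N : nat}
    (G : 'M[scalar_field R k]_N) :
  G = adjoint_mx G ->
  (forall p q, perm_eq (codom (fun j => modulus (G p j) ^+ 2))
                       (codom (fun j => modulus (G q j) ^+ 2))) ->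
  equidistributed G.
Proof.
move=> Ga hG p q; have [pi hpi] := perm_eq_codom_perm _ _ (hG p q).
exists pi => j.
have sym i l : modulus (G i l) = modulus (G l i).
  by rewrite {1}Ga !mxE modulus_conj.
rewrite sym [RHS]sym; apply/eqP.
by rewrite -(eqrXn2 (n := 2)) ?modulus_ge0 // hpi.
Qed.

Theorem corollary4p21 (R : realType) (k : scalar_kind) (N K : nat)
    (hK : (1 <= K)%N) (hKN : (K <= N)%N)
    (Psi : 'M[scalar_field R k]_N -> R)
    (Psi_ge0 : forall H, grassmannian R k N K H -> 0 <= Psi H)
    (Psi_analytic : real_analytic_on (grassmannian R k N K) Psi)
    (I J : set R)
    (I_open : open I) (I_itv : is_interval I) (I_neq0 : I !=set0)
    (I_pos : forall a, I a -> 0 < a)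
    (J_open : open J) (J_itv : is_interval J) (J_neq0 : J !=set0)
    (J_pos : forall b, J b -> 0 < b)
    (G : 'M[scalar_field R k]_N) (hG : grassmannian R k N K G)
    (G_equal_norm : equal_norm G)
    (G_nonzero : forall i j : 'I_N, G i j != 0)
    (G_critical : forall alpha beta : R, I alpha -> J beta ->
       is_riemannian_gradient (grassmannian R k N K)
         (fun H => Psi H + chain_potential alpha beta H) G 0) :
  equidistributed G.
Proof.
have [_ Ga _] := hG.
apply: row_moduli_equidistributed => // p q.
apply: (exp_sums_perm_eq I) => // alpha Ialpha.
have a0 : alpha != 0 by rewrite gt_eqF ?I_pos.
have [beta Jbeta] := J_neq0; have [e e0 he] := open_itv_right _ _ J_open Jbeta.
pose beta' := beta + e / 2.
have Jbeta' : J beta'.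
  by apply: he; rewrite divr_ge0 ?(ltW e0) //= ltr_pdivrMr // ltr_pMr ?ltr1n.
have bb : beta != beta'.
  by rewrite -subr_eq0 opprD addNKr oppr_eq0 mulf_neq0 ?gt_eqF // invr_gt0.
have im0 i : scalar_im (G i i) = 0.
  have := congr1 (fun A : 'M[scalar_field R k]_N => scalar_im (A i i)) Ga.
  rewrite !mxE scalar_im_conj.
  by move=> /esym/eqP; rewrite eqNr => /eqP.
rewrite !big_image /=.
have row_const : off_diag_row_sum alpha G p = off_diag_row_sum alpha G q.
  apply: cyclic_balance_const => {}p {}q pq.
  have [u uu uG] := unit_phase (G q p) (G_nonzero q p).
  pose S := plane_generator u p q.
  have [gM g0 gX] := conj_rotation_curve S G (plane_generator_skew u p q)
    (plane_generator_cube u p q pq uu) hG.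
  have crit b : b \in [:: beta; beta'] -> is_riemannian_gradient
      (grassmannian R k N K) (fun H => Psi H + chain_potential alpha b H) G 0.
    by rewrite !inE => /orP[] /eqP ->; exact: G_critical.
  have := critical_row_sum_balance (grassmannian R k N K) Psi alpha beta beta'
    G _ _ a0 bb im0 (fun i => G_nonzero i i) G_equal_norm crit gM g0 gX.
  have m0 : 2 * modulus (G q p) != 0.
    by apply: mulf_neq0; rewrite ?pnatr_eq0 ?modulus_eq0.
  under eq_bigr do rewrite !plane_generator_commutator_diag // -mulrBr mulrCA.
  by rewrite -mulr_sumr => /eqP; rewrite mulf_eq0 (negbTE m0) /= => /eqP.
have split_row x : \sum_j expR (alpha * modulus (G x j) ^+ 2) =
    expR (alpha * modulus (G x x) ^+ 2) + off_diag_row_sum alpha G x.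
  exact: bigD1.
by rewrite !split_row row_const (G_equal_norm p q).
Qed.
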